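(* The PMFHT is periodic in the fractional order $\alpha$ if and only if all eigenvalues $\{\omega_i\}$ of $F_M$ are roots of unity. Specifically, if there exists a positive integer $k$ such that $\omega_i^k=1$ for all $i$, then $F_M^{(\alpha+k)}=F_M^{(\alpha)}$ for all $\alpha\in\mathbb{R}$.
   Context: Discrete Laplace–Beltrami data. Let $P=\{p_1,\dots,p_N\}\subset\mathbb{R}^3$ be a point cloud sampled from a compact Riemannian manifold $M$ without boundary (a surface), and let $t>0$, $\varepsilon>0$ and $\delta\ge 10\varepsilon$. For each $i$, let $\hat T_{p_i}$ be the estimated tangent plane at $p_i$ (the best-fitting plane to the points of $P$ in the ball of radius $10\varepsilon$ around $p_i$), and let $b_{ii}>0$ be the area of the Voronoi cell of $p_i$ in the Euclidean Voronoi diagram, on $\hat T_{p_i}$, of the projections of the points of $P$ in the ball $B(p_i,\delta)$. Let $B=\mathrm{diag}(b_{11},\dots,b_{NN})$ (the mass matrix) and let $Q$ be the real symmetric matrix with $q_{ij}=\frac{b_{ii}b_{jj}}{4\pi t^2}\exp\left(-\frac{\|p_i-p_j\|^2}{4t}\right)$ for $i\ne j$ and $q_{ii}=-\sum_{j\neq i}q_{ij}$. Let $H\in\mathbb{R}^{N\times N}$ be the matrix whose columns $H_i$ are generalized eigenvectors, $QH_i=-\lambda_i BH_i$, normalized so that $H^\top BH=I$. Fractional matrix and transform. Put $F_M:=H^\top B^{1/2}$, a real orthogonal matrix. Take a spectral decomposition $F_M=V\Omega V^*$ with $V$ unitary and $\Omega=\mathrm{diag}(\omega_1,\dots,\omega_N)$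 containing the eigenvalues of $F_M$, which lie on the unit circle. For $\alpha\in\mathbb{R}$ put $F_M^{(\alpha)}:=V\Omega^\alpha V^*$ with $\Omega^\alpha=\mathrm{diag}(\omega_1^\alpha,\dots,\omega_N^\alpha)$, where $\omega_i^\alpha:=e^{\mathrm{i}\alpha\theta_i}$ for a real argument $\theta_i$ of $\omega_i$ (that is, $\omega_i=e^{\mathrm{i}\theta_i}$) fixed once for all $\alpha$. The point cloud manifold fractional harmonic transform (PMFHT) of order $\alpha$ of a signal $f$ on the point cloud is $\hat f^{(\alpha)}=F_M^{(\alpha)}(B^{1/2}f)$, with inverse $f=B^{-1/2}F_M^{(-\alpha)}\hat f^{(\alpha)}$; $F_M^{(\alpha)}$ is called the PMFHT matrix of order $\alpha$.
   Formalization: ''Periodic in α'' is taken to mean having a positive integer period; with arbitrary real periods the ''only if'' direction is false (eigenvalues 1, 1, e^{iφ}, e^{-iφ}, with φ/π irrational and arguments 0, 0, φ, -φ, give period 2π/φ). *)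

(* Defs.v *)
From HB Require Import structures.
From mathcomp Require Import all_boot all_order all_algebra.
From mathcomp Require Import all_classical all_reals all_analysis.
From mathcomp Require Import complex.

Set Implicit Arguments.
Unset Strict Implicit.
Unset Printing Implicit Defensive.

Import Order.TTheory GRing.Theory Num.Theory.
Import numFieldNormedType.Exports.

Local Open Scope classical_set_scope.
Local Open Scope ring_scope.
Local Open Scope sesquilinear_scope.

Section Euclidean3.
Variable R : realType.
Implicit Types x y : 'rV[R]_3.

(* The norm `|x| that the library puts on matrices is the sup norm. *)
Definition edot x y : R := \sum_(k < 3) x 0 k * y 0 k.

Definition enorm x : R := Num.sqrt (edot x x).

End Euclidean3.

Section Surfaces.
Variable R : realType.

Fixpoint Ck (k : nat) (f : 'rV[R]_3 -> R^o) : Prop :=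
  if k is k'.+1
  then (forall x, differentiable f x) /\ (forall v, Ck k' ('D_v f))
  else continuous f.

Definition smooth (f : 'rV[R]_3 -> R^o) : Prop := forall k, Ck k f.

(* Embedded surface without boundary, as a local zero set of a smooth function
   with nonzero gradient.  Its Riemannian metric is the one induced by R^3, so
   that no further data is needed. *)
Definition regular_surface (M : set 'rV[R]_3) : Prop :=
  forall x, M x -> exists (U : set 'rV[R]_3) (f : 'rV[R]_3 -> R^o),
    [/\ open_nbhs x U, smooth f, (exists v, 'D_v f x != 0)
      & M `&` U = [set y | U y /\ f y = 0]].

End Surfaces.

Section Planes.
Variable R : realType.

(* An affine plane is given by a point and an orthonormal basis of its
   direction; none of the notions below depends on the choice of this frame. *)
Record plane := Plane {
  plane_pt : 'rV[R]_3;
  plane_e1 : 'rV[R]_3;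
  plane_e2 : 'rV[R]_3;
  plane_e11 : edot plane_e1 plane_e1 = 1;
  plane_e22 : edot plane_e2 plane_e2 = 1;
  plane_e12 : edot plane_e1 plane_e2 = 0 }.

Definition plane_chart (T : plane) (a : R * R) : 'rV[R]_3 :=
  plane_pt T + a.1 *: plane_e1 T + a.2 *: plane_e2 T.

Definition plane_set (T : plane) : set 'rV[R]_3 := range (plane_chart T).

Definition plane_proj (T : plane) (x : 'rV[R]_3) : 'rV[R]_3 :=
  plane_chart T (edot (x - plane_pt T) (plane_e1 T),
                 edot (x - plane_pt T) (plane_e2 T)).

(* The chart is an isometry from R^2 onto the plane, so the area is the
   Lebesgue measure in the chart. *)
Definition plane_area (T : plane) (A : set 'rV[R]_3) : \bar R :=
  ((@lebesgue_measure R) \x (@lebesgue_measure R))%E (plane_chart T @^-1` A).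

End Planes.

Section LaplaceBeltrami.
Variables (R : realType) (N : nat) (p : 'I_N -> 'rV[R]_3).

(* Best fit in the sense of (total) least squares: T minimizes the sum of the
   squared orthogonal distances to the points of the cloud lying in the ball. *)
Definition best_fitting_plane (c : 'rV[R]_3) (r : R) (T : plane R) : Prop :=
  let cost (S : plane R) :=
    \sum_(j < N | enorm (p j - c) < r) enorm (p j - plane_proj S (p j)) ^+ 2 in
  forall S, cost T <= cost S.

(* Cell of p i in the Voronoi diagram, on the plane T, of the projections of the
   points of the cloud lying in the ball B(p i, delta). *)
Definition voronoi_cell (delta : R) (T : plane R) (i : 'I_N) : set 'rV[R]_3 :=
  [set x | plane_set T x /\
     forall j, enorm (p j - p i) < delta ->
       enorm (x - plane_proj T (p i)) <= enorm (x - plane_proj T (p j))].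

Variables (t : R) (b : 'rV[R]_N).

Definition mass_mx : 'M[R]_N := diag_mx b.

Definition mass_sqrt_mx : 'M[R]_N := diag_mx (map_mx Num.sqrt b).

Definition stiff_coef (i j : 'I_N) : R :=
  b 0 i * b 0 j / (4 * pi * t ^+ 2) * expR (- (enorm (p i - p j) ^+ 2 / (4 * t))).

Definition stiff_mx : 'M[R]_N :=
  \matrix_(i, j) if i == j then - \sum_(k < N | k != i) stiff_coef i k
                 else stiff_coef i j.

Definition harmonic_basis (lambda : 'I_N -> R) (H : 'M[R]_N) : Prop :=
  (forall i, stiff_mx *m col i H = - lambda i *: (mass_mx *m col i H)) /\
  H^T *m mass_mx *m H = 1%:M.

End LaplaceBeltrami.

Section Transform.
Variables (R : realType) (N : nat).
Implicit Types (b : 'rV[R]_N) (H : 'M[R]_N) (V : 'M[R[i]]_N).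

Definition expi (x : R) : R[i] := Complex (cos x) (sin x).

Definition toC m n (A : 'M[R]_(m, n)) : 'M[R[i]]_(m, n) :=
  map_mx (real_complex R) A.

Definition harmonic_mx b H : 'M[R]_N := H^T *m mass_sqrt_mx b.

Definition spectral_decomp (F : 'M[R[i]]_N) V (omega : 'rV[R[i]]_N) : Prop :=
  V \is unitarymx /\ F = V *m diag_mx omega *m V ^t*.

(* theta lists the chosen arguments of the eigenvalues of harmonic_mx. *)
Definition PMFHT_mx V (theta : 'I_N -> R) (alpha : R) : 'M[R[i]]_N :=
  V *m diag_mx (\row_i expi (alpha * theta i)) *m V ^t*.

Definition PMFHT b V (theta : 'I_N -> R) (alpha : R) (f : 'cV[R]_N) : 'cV[R[i]]_N :=
  PMFHT_mx V theta alpha *m toC (mass_sqrt_mx b *m f).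

(* The periods in the fractional order are positive integers: the chosen
   arguments of a complex conjugate pair of eigenvalues can have a common real
   period without these being roots of unity. *)
Definition PMFHT_periodic b V (theta : 'I_N -> R) : Prop :=
  exists k : nat, (0 < k)%N /\ periodic (PMFHT b V theta) k%:R.

End Transform.

Definition is_root_of_unity (C : nzRingType) (z : C) : Prop :=
  exists n : nat, (0 < n)%N /\ n.-unity_root z.

(* Main.v *)
Require Import Defs.
From HB Require Import structures.
From mathcomp Require Import all_boot all_order all_algebra.
From mathcomp Require Import all_classical all_reals all_analysis.
From mathcomp Require Import complex.

(** The exponents [expi (alpha * theta i)] are one-parameter groups, so shifting
    the order by a natural number [k] multiplies the [i]-th diagonal entry of
    the transform by [expi (theta i) ^+ k], which is [omega 0 i ^+ k]
    (lemma [expiMn], De Moivre).  A common exponent [k] raising all eigenvalues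
    to 1 is therefore a period, and such a [k] exists as soon as each eigenvalue has
    some exponent of its own: take their product.

    Conversely, the mass matrix is invertible, so the transforms of all real
    signals determine the complex matrix of the transform (lemma
    [eq_mx_real_signals]).  Comparing orders [k] and [0] thus gives an equality
    of two matrices that are diagonal in the same unitary basis, hence an
    equality of their diagonals (lemma [unitary_diag_inj]), which reads
    [omega 0 i ^+ k = 1]. *)

Set Implicit Arguments.
Unset Strict Implicit.
Unset Printing Implicit Defensive.

Import Order.TTheory GRing.Theory Num.Theory.
Import numFieldNormedType.Exports.

Local Open Scope classical_set_scope.
Local Open Scope ring_scope.

Local Open Scope sesquilinear_scope.

Lemma expi0 (R : realType) : expi 0 = 1 :> R[i].
Proof. by rewrite /expi cos0 sin0. Qed.

Lemma expiD (R : realType) (x y : R) : expi (x + y) = expi x * expi y.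
Proof.
by apply/eqP; rewrite eq_complex /= cosD sinD eqxx /= addrC.
Qed.

Lemma expiMn (R : realType) (k : nat) (x : R) : expi (k%:R * x) = expi x ^+ k.
Proof.
elim: k => [|k IHk]; first by rewrite mul0r expi0 expr0.
by rewrite -natr1 mulrDl mul1r expiD IHk exprSr.
Qed.

Lemma unitary_diag_inj (R : realType) (N : nat) (V : 'M[R[i]]_N)
    (d e : 'rV[R[i]]_N) : V \is unitarymx ->
  V *m diag_mx d *m V ^t* = V *m diag_mx e *m V ^t* -> d = e.
Proof.
move=> Vu eqde; have VtV : V ^t* *m V = 1%:M.
  by apply: mulmx1C; apply/unitarymxP.
have /matrixP eq_diag : diag_mx d = diag_mx e.
  have := congr1 (fun A => V ^t* *m A *m V) eqde.
  by rewrite !mulmxA VtV !mul1mx -!mulmxA VtV !mulmx1.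
by apply/rowP => i; have := eq_diag i i; rewrite !mxE eqxx !mulr1n.
Qed.

(** The real unit vectors are also a basis over the complex numbers, so a
    complex matrix is determined by its action on real signals. *)
Lemma eq_mx_real_signals (R : realType) (N : nat) (S : 'M[R]_N)
    (A B : 'M[R[i]]_N) : S \in unitmx ->
  (forall f : 'cV[R]_N, A *m toC (S *m f) = B *m toC (S *m f)) -> A = B.
Proof.
move=> Su eqAB; apply/matrixP => i j.
have := eqAB (invmx S *m delta_mx j 0).
rewrite mulKVmx // /toC map_delta_mx -!colE => /colP /(_ i).
by rewrite !mxE.
Qed.

Lemma mass_sqrt_mx_unit (R : realType) (N : nat) (b : 'rV[R]_N) :
  (forall i, 0 < b 0 i) -> mass_sqrt_mx b \in unitmx.
Proof.
move=> b_gt0; rewrite unitmxE /mass_sqrt_mx det_diag unitfE.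
by apply/prodf_neq0 => i _; rewrite mxE gt_eqF // sqrtr_gt0.
Qed.

Lemma PMFHT_mx_period (R : realType) (N : nat) (V : 'M[R[i]]_N)
    (theta : 'I_N -> R) (k : nat) : (forall i, expi (theta i) ^+ k = 1) ->
  forall alpha, PMFHT_mx V theta (alpha + k%:R) = PMFHT_mx V theta alpha.
Proof.
move=> thetak alpha; rewrite /PMFHT_mx; congr (_ *m diag_mx _ *m _).
by apply/rowP => i; rewrite !mxE mulrDl expiD expiMn thetak mulr1.
Qed.

(** Orders [0] and [k] give the same transform of every signal, hence the same
    matrix; at order [0] its diagonal is constantly 1. *)
Lemma PMFHT_periodic_expr (R : realType) (N : nat) (b : 'rV[R]_N)
    (V : 'M[R[i]]_N) (theta : 'I_N -> R) (k : nat) :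
  (forall i, 0 < b 0 i) -> V \is unitarymx ->
  periodic (PMFHT b V theta) k%:R -> forall i, expi (theta i) ^+ k = 1.
Proof.
move=> b_gt0 Vu per i.
have /(unitary_diag_inj Vu) /rowP /(_ i) :
    PMFHT_mx V theta k%:R = PMFHT_mx V theta 0.
  apply: (eq_mx_real_signals (mass_sqrt_mx_unit b_gt0)) => f.
  by have := congr1 (fun F => F f) (per 0); rewrite /PMFHT add0r.
by rewrite !mxE mul0r expi0 expiMn.
Qed.

Lemma common_unity_exponent (C : nzRingType) (I : finType) (z : I -> C) :
  (forall i, is_root_of_unity (z i)) ->
  exists k : nat, (0 < k)%N /\ forall i, z i ^+ k = 1.
Proof.
move=> /choice[n nP]; exists (\prod_i n i)%N; split.
  by apply: prodn_gt0 => i; have [] := nP i.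
move=> i; have [_ /unity_rootP zn1] := nP i.
by rewrite (bigD1 i) //= exprM zn1 expr1n.
Qed.

Theorem mainTheorem3 (R : realType)
    (M : set 'rV[R]_3) (M_compact : compact M) (M_surface : regular_surface M)
    (N : nat) (p : 'I_N -> 'rV[R]_3) (p_inj : injective p)
    (p_sampled : forall i, M (p i))
    (t eps delta : R) (t_gt0 : 0 < t) (eps_gt0 : 0 < eps)
    (delta_ge : 10 * eps <= delta)
    (T : 'I_N -> plane R)
    (T_fit : forall i, best_fitting_plane p (p i) (10 * eps) (T i))
    (b : 'rV[R]_N) (b_gt0 : forall i, 0 < b 0 i)
    (b_area : forall i,
       (b 0 i)%:E = plane_area (T i) (voronoi_cell p delta (T i) i))
    (H : 'M[R]_N) (lambda : 'I_N -> R)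
    (H_basis : harmonic_basis p t b lambda H)
    (V : 'M[R[i]]_N) (omega : 'rV[R[i]]_N)
    (F_spec : spectral_decomp (toC (harmonic_mx b H)) V omega)
    (theta : 'I_N -> R) (theta_arg : forall i, omega 0 i = expi (theta i)) :
  (PMFHT_periodic b V theta <-> forall i, is_root_of_unity (omega 0 i)) /\
  (forall k : nat, (0 < k)%N -> (forall i, omega 0 i ^+ k = 1) ->
     forall alpha : R,
       PMFHT_mx V theta (alpha + k%:R) = PMFHT_mx V theta alpha).
Proof.
have [Vu _] := F_spec.
have period k : (forall i, omega 0 i ^+ k = 1) -> forall alpha,
    PMFHT_mx V theta (alpha + k%:R) = PMFHT_mx V theta alpha.
  by move=> omegak; apply: PMFHT_mx_period => i; rewrite -theta_arg.
split; last by move=> k _; exact: period.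
split=> [[k [k_gt0 per]] i | /common_unity_exponent[k [k_gt0 omegak]]].
  exists k; split=> //; apply/unity_rootP.
  by rewrite theta_arg (PMFHT_periodic_expr b_gt0 Vu per).
by exists k; split=> // alpha; apply/funext => f; rewrite /PMFHT period.
Qed.
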